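(* Let $R$ be an integral domain, and let $S$ be a splitting multiplicative subset of $R$ generated by primes. If the localization $R_S$ of $R$ at $S$ is weak-ACCP, then $R$ is weak-ACCP.
   Context: Multiplicative subsets do not contain $0$. A saturated multiplicative subset $S$ of an integral domain $R$ is called splitting if every $r \in R$ can be written as $r = as$ for some $a \in R$ and $s \in S$ such that $Ra \cap Rs' = Ras'$ for all $s' \in S$. (Saturated: every divisor in $R$ of an element of $S$ lies in $S$.) $S$ is generated by primes if every element of $S$ is a unit of $R$ times a finite (possibly empty) product of prime elements of $R$ lying in $S$. An integral domain $R$ is atomic if every nonzero nonunit of $R$ is a finite product of irreducibles. An element $x\in R$ satisfies ACCP (in $R$) if every ascending chain of principal ideals of $R$ starting at $Rx$ eventually stabilizes. An integral domain $R$ is weak-ACCP if it is atomic and every nonempty finite subset $W$ of $R\setminus\{0\}$ has a common divisor $d\in R$ such that $\frac{w}{d}$ satisfies ACCP in $R$ for some $w\in W$. *)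

(* Defs.v *)
From HB Require Import structures.
From mathcomp Require Import all_boot all_order all_algebra.
From mathcomp Require Import boolp classical_sets functions cardinality.

Set Implicit Arguments.
Unset Strict Implicit.
Unset Printing Implicit Defensive.

Import GRing.Theory.
Local Open Scope classical_set_scope.
Local Open Scope ring_scope.

Section Divisibility.
Variable R : idomainType.

Definition divides (d x : R) : Prop := exists c : R, x = c * d.

Definition principal_ideal (x : R) : set R := [set c * x | c in [set: R]].

Definition irreducible_elt (a : R) : Prop :=
  [/\ a != 0, a \isn't a GRing.unit &
      forall b c : R, a = b * c -> b \is a GRing.unit \/ c \is a GRing.unit].

Definition prime_elt (p : R) : Prop :=
  [/\ p != 0, p \isn't a GRing.unit &
      forall b c : R, divides p (b * c) -> divides p b \/ divides p c].

Definition atomic : Prop :=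
  forall x : R, x != 0 -> x \isn't a GRing.unit ->
    exists s : seq R,
      (forall a : R, a \in s -> irreducible_elt a) /\ x = \prod_(a <- s) a.

Definition satisfies_ACCP (x : R) : Prop :=
  forall I : nat -> set R,
    (forall n, exists a : R, I n = principal_ideal a) ->
    I 0%N = principal_ideal x ->
    (forall n, I n `<=` I n.+1) ->
    exists N : nat, forall n : nat, (N <= n)%N -> I n = I N.

(* In the last clause [c] is the quotient w/d, which is unique because
   [d] divides the nonzero element [w]. *)
Definition weak_ACCP : Prop :=
  atomic /\
  forall W : set R, finite_set W -> W !=set0 -> ~ W 0 ->
    exists d : R, (forall w, W w -> divides d w) /\
      exists w c : R, [/\ W w, w = c * d & satisfies_ACCP c].

Definition multiplicative_subset (S : set R) : Prop :=
  [/\ S 1, forall s t : R, S s -> S t -> S (s * t) & ~ S 0].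

Definition saturated (S : set R) : Prop :=
  forall d s : R, S s -> divides d s -> S d.

Definition splitting (S : set R) : Prop :=
  [/\ multiplicative_subset S, saturated S &
      forall r : R, exists a s : R, [/\ S s, r = a * s &
        forall s' : R, S s' ->
          principal_ideal a `&` principal_ideal s' = principal_ideal (a * s')]].

Definition generated_by_primes (S : set R) : Prop :=
  forall x : R, S x -> exists (u : R) (t : seq R),
    [/\ u \is a GRing.unit,
        forall p : R, p \in t -> S p /\ prime_elt p &
        x = u * \prod_(p <- t) p].

End Divisibility.

Arguments atomic : clear implicits.
Arguments weak_ACCP : clear implicits.

Local Notation "x %:F" := (@FracField.tofrac _ x).

(* The localization of R at S, as the subring {a/s | a in R, s in S} of the
   fraction field of R. The proof [mS] is a phantom argument, from which
   the ring structure can be inferred. *)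
Section Localization.
Variables (R : idomainType) (S : set R) (mS : multiplicative_subset S).

Definition fractions_over of multiplicative_subset S : {pred {fraction R}} :=
  [pred x | `[< exists a s : R, S s /\ x = a%:F / s%:F >]].

Definition localization : Type :=
  {x : {fraction R} | x \in fractions_over mS}.

Lemma tofrac_neq0 s : S s -> s%:F != 0 :> {fraction R}.
Proof.
by case: mS => _ _ S0 Ss; rewrite tofrac_eq0; apply/eqP => s0; rewrite s0 in Ss.
Qed.

Lemma fractions_over_subring : subring_closed (fractions_over mS).
Proof.
have [S1 SM _] := mS; split.
- by apply/asboolP; exists 1, 1; split=> //; rewrite tofrac1 divr1.
- move=> _ _ /asboolP[a [s [Ss ->]]] /asboolP[b [t [St ->]]]; apply/asboolP.
  exists (a * t - b * s), (s * t); split; first exact: SM.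
  by rewrite tofracB !tofracM -mulNr addf_div ?tofrac_neq0// mulNr.
- move=> _ _ /asboolP[a [s [Ss ->]]] /asboolP[b [t [St ->]]]; apply/asboolP.
  exists (a * b), (s * t); split; first exact: SM.
  by rewrite !tofracM mulf_div.
Qed.

HB.instance Definition _ := GRing.isSubringClosed.Build {fraction R}
  (fractions_over mS) fractions_over_subring.

Local Notation L := localization.

HB.instance Definition _ := SubChoice.on L.
HB.instance Definition _ := [SubChoice_isSubComNzRing of L by <:].

Definition localization_unit : {pred L} :=
  [pred x | (val x != 0) && ((val x)^-1 \in fractions_over mS)].

Definition localization_inv (x : L) : L :=
  if x \in localization_unit then insubd x (val x)^-1 else x.

Fact localization_mulVx :
  {in localization_unit, left_inverse 1 localization_inv *%R}.
Proof.
move=> x xU; apply: val_inj; rewrite /localization_inv xU.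
have /andP[x0 xV] := xU.
by rewrite rmorphM rmorph1 /= val_insubd xV mulVf.
Qed.

Fact localization_unitPl (x y : L) : y * x = 1 -> x \in localization_unit.
Proof.
move=> /(congr1 val); rewrite rmorphM rmorph1 /= => yx1.
have x0 : val x != 0.
  by apply: contra_eq_neq yx1 => ->; rewrite mulr0 eq_sym oner_neq0.
rewrite inE x0 /=; suff -> : (val x)^-1 = val y by exact: valP.
by apply: (mulIf x0); rewrite mulVf.
Qed.

Fact localization_inv_out :
  {in [predC localization_unit], localization_inv =1 id}.
Proof. by move=> x; rewrite inE /localization_inv => /negbTE ->. Qed.

HB.instance Definition _ := GRing.ComNzRing_hasMulInverse.Build L
  localization_mulVx localization_unitPl localization_inv_out.

Fact localization_idomain : GRing.integral_domain_axiom L.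
Proof.
move=> x y /(congr1 val) /eqP; rewrite rmorphM rmorph0 /= mulf_eq0.
by rewrite -!(inj_eq val_inj) rmorph0.
Qed.

HB.instance Definition _ :=
  GRing.ComUnitRing_isIntegral.Build L localization_idomain.

End Localization.

(* Main.v *)
From HB Require Import structures.
Require Import Defs.
From mathcomp Require Import all_boot all_order all_algebra.
From mathcomp Require Import boolp classical_sets functions cardinality.

(** Every nonzero element of R is [a * s] with [s] in S and [a] free of S, that
is, divisible by no prime lying in S.  Both factors are under control.  The
factor [s] is a unit times a product of primes, so it factors into
irreducibles and has boundedly many nonunit factors ([size_primes_dvd]).  The
factor [a] does not see the difference between R and R_S: a free element that
divides [b] in R_S already divides it in R ([S_free_divides_loc]), since
the primes in a denominator can be cancelled one at a time.  Moreover every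
nonzero element of R_S is, up to a unit of R_S, a free element of R
([S_free_representative]), so the data that R_S provides can be taken in R.

Atomicity: up to units of R_S, the irreducible factors of [a] in R_S are
represented by free elements of R.  These remain irreducible in R, because a
factor that becomes a unit in R_S lies in S, hence is a unit of R when it
divides a free element.  Their product is free and associated to [a] in R_S,
hence in R.

ACCP: a nonzero element [x] of R that satisfies ACCP in R_S satisfies it in R
([ACCP_descent]).  Indeed a chain of ideals of R starting at [R x] stabilizes
in R_S, and from there on successive quotients of generators are units of R_S,
hence lie in S; since they multiply to divisors of one fixed element, only
finitely many of them are nonunits of R.

Finally, for a finite set W the common divisor found in R_S may be taken free;
it then divides every element of W in R, and the quotient that satisfies ACCP
in R_S does so in R. *)

Set Implicit Arguments.
Unset Strict Implicit.
Unset Printing Implicit Defensive.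

Import GRing.Theory.
Local Open Scope classical_set_scope.
Local Open Scope ring_scope.

(** * Divisibility and prime elements *)

Section Divisibility.
Variable R : idomainType.
Implicit Types a b c d p q u x : R.

Lemma divides_refl a : divides a a.
Proof. by exists 1; rewrite mul1r. Qed.

Lemma divides_trans b a c : divides a b -> divides b c -> divides a c.
Proof. by move=> [k ->] [l ->]; exists (l * k); rewrite mulrA. Qed.

Lemma divides_mull a b c : divides a c -> divides a (b * c).
Proof. by move=> [k ->]; exists (b * k); rewrite mulrA. Qed.

Lemma divides_mulr a b c : divides a b -> divides a (b * c).
Proof. by rewrite mulrC; exact: divides_mull. Qed.

Lemma divides_mul2l c a b : divides a b -> divides (c * a) (c * b).
Proof. by move=> [k ->]; exists k; rewrite mulrCA. Qed.

Lemma divides_cancell c a b : c != 0 -> divides (c * a) (c * b) -> divides a b.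
Proof.
by move=> c0 [k]; rewrite mulrCA => /(mulfI c0) ->; exists k.
Qed.

Lemma divides_unit d u : u \is a GRing.unit -> divides d u ->
  d \is a GRing.unit.
Proof. by move=> uu [k ku]; move: uu; rewrite ku unitrM => /andP[]. Qed.

Lemma unit_neq0 u : u \is a GRing.unit -> u != 0.
Proof. by apply: contraTneq => ->; rewrite unitr0. Qed.

Lemma divides_antisym a b : a != 0 -> divides a b -> divides b a ->
  exists2 u, u \is a GRing.unit & a = u * b.
Proof.
move=> a0 [k bE] [l aE]; exists l => //.
suff lk1 : l * k = 1 by apply/unitrPr; exists k.
by apply: (mulIf a0); rewrite -mulrA -bE -aE mul1r.
Qed.

Lemma mem_principal_ideal a : principal_ideal a a.
Proof. by exists 1; rewrite ?mul1r. Qed.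

Lemma principal_ideal_sub a b :
  principal_ideal a `<=` principal_ideal b <-> divides b a.
Proof.
split=> [/(_ a (mem_principal_ideal a)) [k _ <-]|[k ->]]; first by exists k.
by move=> _ [l _ <-]; exists (l * k); rewrite ?mulrA.
Qed.

Lemma eq_principal_ideal a b :
  principal_ideal a = principal_ideal b <-> divides a b /\ divides b a.
Proof.
split=> [e|[ab ba]]; last by apply/seteqP; split; apply/principal_ideal_sub.
by split; apply/principal_ideal_sub; rewrite e.
Qed.

Lemma prime_irreducible p : prime_elt p -> irreducible_elt p.
Proof.
move=> [p0 pU pP]; split=> // b c pE.
have half x y : p = x * y -> divides p x -> y \is a GRing.unit.
  move=> xyE [k xE]; apply/unitrPr; exists k; apply: (mulIf p0).
  by rewrite -mulrA -xE mulrC mul1r -xyE.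
have [|/(half _ _ pE)|cp] := pP b c; [|by right|].
  by rewrite -pE; exact: divides_refl.
by left; apply: half cp; rewrite mulrC.
Qed.

Lemma prime_divides_prod p (s : seq R) : prime_elt p ->
  divides p (\prod_(x <- s) x) -> exists2 x, x \in s & divides p x.
Proof.
move=> pp; have [_ pU pP] := pp; elim: s => [|a s IHs].
  by rewrite big_nil => /(divides_unit (unitr1 R)); rewrite (negbTE pU).
rewrite big_cons => /pP[pa|/IHs[x xs px]]; first by exists a; rewrite ?mem_head.
by exists x; rewrite // inE xs orbT.
Qed.

(** The unit can be absorbed by the first factor, and there is one because the
product is not a unit. *)
Lemma absorb_unit u (s : seq R) : u \is a GRing.unit ->
  (forall a, a \in s -> irreducible_elt a) ->
  u * \prod_(a <- s) a \isn't a GRing.unit ->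
  exists s' : seq R, (forall a, a \in s' -> irreducible_elt a) /\
    u * \prod_(a <- s) a = \prod_(a <- s') a.
Proof.
case: s => [|a s] uU sI; first by rewrite big_nil mulr1 uU.
move=> _; exists (u * a :: s); split; last by rewrite !big_cons mulrA.
move=> b; rewrite inE => /orP[/eqP ->|bs]; last first.
  by apply: sI; rewrite inE bs orbT.
have [a0 aU aI] := sI a (mem_head _ _); split.
- by rewrite mulf_neq0 // unit_neq0.
- by rewrite unitrMr.
- move=> c d cdE; have aE : a = u^-1 * c * d by rewrite -mulrA -cdE mulKr.
  by have := aI _ _ aE; rewrite unitrMr ?unitrV.
Qed.

End Divisibility.

(** * Elements free of the primes in S *)

Section Free.
Variables (R : idomainType) (S : set R).
Hypotheses (sS : splitting S) (Sp : generated_by_primes S).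
Implicit Types a b c p q r x : R.

Definition S_prime p : Prop := S p /\ prime_elt p.

Definition S_free a : Prop := forall p, S_prime p -> ~ divides p a.

(** The primes of [s] can be cancelled one by one from [a * c = s * b]: none
of them divides [a], so each divides [c]. *)
Lemma S_free_cancel a s b : S_free a -> S s -> divides a (s * b) ->
  divides a b.
Proof.
move=> fa /Sp[u [t [uU tP ->]]] {s}.
rewrite -mulrA => /(divides_mull u^-1); rewrite mulKr //.
elim: t tP => [|p t IHt] tP; first by rewrite big_nil mul1r.
rewrite big_cons -mulrA => -[c cE].
have [Sq [p0 _ pP]] := tP p (mem_head _ _).
apply: IHt => [q qt|]; first by apply: tP; rewrite inE qt orbT.
have [||[k ck]] := pP c a.
- by rewrite -cE; exact/divides_mulr/divides_refl.
- move=> [k ck]; exists k; apply: (mulfI p0).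
  by rewrite cE ck mulrCA !mulrA.
- by case: (fa p (tP p (mem_head _ _))); exists k.
Qed.

Lemma S_free_prod (s : seq R) : (forall a, a \in s -> S_free a) ->
  S_free (\prod_(a <- s) a).
Proof.
move=> fs p pS /(prime_divides_prod pS.2)[a /fs]; exact.
Qed.

Lemma S_nonunit_divisor x : S x -> x \isn't a GRing.unit ->
  exists2 p, S_prime p & divides p x.
Proof.
move=> /Sp[u [[|p t] [uU tP ->]]]; first by rewrite big_nil mulr1 uU.
move=> _; exists p; first exact: (tP p (mem_head _ _)).
by rewrite big_cons; exact/divides_mull/divides_mulr/divides_refl.
Qed.

Lemma S_free_divisor_unit a x : S_free a -> S x -> divides x a ->
  x \is a GRing.unit.
Proof.
move=> fa Sx xa; apply: contrapT => /negP /(S_nonunit_divisor Sx)[p pS px].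
exact: fa pS (divides_trans px xa).
Qed.

(** A prime of [t] divides, hence is associated to, an entry of [t0], and the
two can be cancelled. *)
Lemma size_primes_dvd a (t t0 : seq R) : S_free a ->
  (forall p, p \in t -> S_prime p) -> (forall p, p \in t0 -> S_prime p) ->
  divides (\prod_(p <- t) p) (a * \prod_(p <- t0) p) -> (size t <= size t0)%N.
Proof.
move=> fa; elim: t t0 => [//|p t IHt] t0 tP t0P; rewrite big_cons => ptd.
have pS := tP p (mem_head _ _); have [_ [p0 pU pP]] := pS.
have pd : divides p (a * \prod_(q <- t0) q).
  by apply: divides_trans ptd; exact/divides_mulr/divides_refl.
have [pa|] := pP _ _ pd; first by case: (fa p pS).
move=> /(prime_divides_prod pS.2)[q qt0 [v qE]].
have vU : v \is a GRing.unit.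
  have [_ _ /(_ v p qE)[//|]] := prime_irreducible (t0P q qt0).2.
  by rewrite (negbTE pU).
have sE : size t0 = (size (rem q t0)).+1.
  by rewrite size_rem // prednK // lt0n size_eq0; case: (t0) qt0.
rewrite sE /= ltnS; apply: IHt => [r rt|r /mem_rem rt|].
- by apply: tP; rewrite inE rt orbT.
- exact: t0P.
set c := \prod_(r <- rem q t0) r.
have t0E : a * \prod_(r <- t0) r = p * (v * (a * c)).
  by rewrite (big_rem q qt0) /= {1}qE mulrCA -mulrA mulrCA.
move: ptd; rewrite t0E => /(divides_cancell p0)/(divides_mull v^-1).
by rewrite mulKr.
Qed.

(** The intersection condition for [a] at a prime [p] of S that divides [a]
would give that [a * p] divides [a], so that [p] would be a unit. *)
Lemma S_free_decomposition r : r != 0 ->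
  exists a s, [/\ S s, r = a * s & S_free a].
Proof.
move=> r0; have [_ _ /(_ r)[a [s [Ss rE aP]]]] := sS.
exists a, s; split=> // p [Sp' [_ pU _]] [k aE].
have a0 : a != 0 by apply: contra_neq r0 => a0; rewrite rE a0 mul0r.
have : principal_ideal (a * p) a.
  rewrite -aP //; split; first exact: mem_principal_ideal.
  by exists k.
move=> [l _ lE]; apply/negP: pU; apply/negPn/unitrPr; exists l.
by apply: (mulIf a0); rewrite mul1r -[RHS]lE -mulrA mulrC -mulrA.
Qed.

Lemma S_prime_divisor_bound r : r != 0 -> exists B : nat,
  forall t : seq R, (forall p, p \in t -> S_prime p) ->
    divides (\prod_(p <- t) p) r -> (size t <= B)%N.
Proof.
move=> /S_free_decomposition[a [s [/Sp[u [t0 [uU t0P ->]]] -> fa]]].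
exists (size t0) => t tP; rewrite mulrCA => /(divides_mull u^-1).
by rewrite (mulKr uU); exact: (size_primes_dvd fa tP t0P).
Qed.

End Free.

(** * Localization maps *)

(** For a multiplicative subset S, this characterizes [R -> R_S] up to
isomorphism.  Arguing with an abstract L keeps the construction of R_S as a
subring of the fraction field out of the proofs. *)
Definition localization_map (R L : idomainType) (S : set R)
    (f : {rmorphism R -> L}) : Prop :=
  [/\ injective f, forall s, S s -> f s \is a GRing.unit &
      forall x, exists a s, S s /\ x * f s = f a].

Section LocalizationMap.
Variables (R L : idomainType) (S : set R) (f : {rmorphism R -> L}).
Hypothesis fS : localization_map S f.
Hypotheses (sS : splitting S) (Sp : generated_by_primes S).
Implicit Types (a b s : R) (x y : L).

Lemma loc_inj : injective f.
Proof. by case: fS. Qed.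

Lemma loc_eq0 a : (f a == 0) = (a == 0).
Proof. by rewrite -(inj_eq loc_inj) rmorph0. Qed.

Lemma loc_unit s : S s -> f s \is a GRing.unit.
Proof. by case: fS => _ + _; exact. Qed.

Lemma loc_fraction x : exists a s, S s /\ x * f s = f a.
Proof. by case: fS. Qed.

Lemma divides_loc a b : divides a b -> divides (f a) (f b).
Proof. by move=> [k ->]; exists (f k); rewrite rmorphM. Qed.

Lemma divides_locP a b : divides (f a) (f b) ->
  exists2 s, S s & divides a (s * b).
Proof.
move=> [x bE]; have [c [s [Ss xE]]] := loc_fraction x.
exists s => //; exists c; apply: loc_inj.
by rewrite !rmorphM bE -xE mulrCA mulrA.
Qed.

Lemma loc_unit_S a : f a \is a GRing.unit -> S a.
Proof.
have [_ satS _] := sS.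
move=> aU; have : divides (f a) (f 1).
  by exists (f a)^-1; rewrite rmorph1 mulVr.
by move=> /divides_locP[s Ss]; rewrite mulr1; exact: satS.
Qed.

Lemma S_free_divides_loc a b : S_free S a ->
  divides (f a) (f b) -> divides a b.
Proof.
by move=> fa /divides_locP[s Ss]; exact: (S_free_cancel Sp).
Qed.

Lemma S_free_representative x : x != 0 -> exists a v,
  [/\ S_free S a, v \is a GRing.unit & x = v * f a].
Proof.
move=> x0; have [b [s [Ss xE]]] := loc_fraction x.
have b0 : b != 0.
  by rewrite -loc_eq0 -xE mulf_neq0 // unit_neq0 // loc_unit.
have [a [t [St bE fa]]] := S_free_decomposition sS b0.
exists a, (f t / f s); split=> //.
  by rewrite unitrMr ?unitrV loc_unit.
apply: (mulIr (loc_unit Ss)); rewrite xE bE rmorphM.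
by rewrite mulrAC divrK ?loc_unit // mulrC.
Qed.

(** * Atomicity *)

(** In a factorization of [a] in R, a factor that becomes a unit in R_S lies in
S by saturation, and a divisor of a free element that lies in S is a unit. *)
Lemma S_free_irreducible a v : S_free S a -> v \is a GRing.unit ->
  irreducible_elt (v * f a) -> irreducible_elt a.
Proof.
move=> fa vU [va0 vaU vaI]; split.
- by apply: contra_neq va0 => ->; apply/eqP; rewrite mulf_eq0 loc_eq0 eqxx orbT.
- by apply: contra vaU => aU; rewrite unitrMr // rmorph_unit.
move=> b c aE.
have unitP d : divides d a -> f d \is a GRing.unit -> d \is a GRing.unit.
  move=> da /loc_unit_S Sd.
  exact: (S_free_divisor_unit Sp fa Sd da).
have [|bU|cU] := vaI (v * f b) (f c); first by rewrite aE rmorphM mulrA.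
- left; apply: unitP; first by rewrite aE; exact/divides_mulr/divides_refl.
  by move: bU; rewrite unitrMr.
- by right; apply: unitP => //; rewrite aE; exact/divides_mull/divides_refl.
Qed.

Lemma irreducible_representatives (l : seq L) :
  (forall x, x \in l -> irreducible_elt x) ->
  exists v (m : seq R), [/\ v \is a GRing.unit,
    forall a, a \in m -> S_free S a /\ irreducible_elt a &
    \prod_(x <- l) x = v * f (\prod_(a <- m) a)].
Proof.
elim: l => [|x l IHl] lI.
  by exists 1, [::]; rewrite !big_nil rmorph1 mulr1 unitr1.
have [y yl|v [m [vU mP lE]]] := IHl; first by apply: lI; rewrite inE yl orbT.
have xI := lI x (mem_head _ _); have [x0 _ _] := xI.
have [a [w [fa wU xE]]] := S_free_representative x0.
exists (w * v), (a :: m); split; first by rewrite unitrMr.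
  move=> b; rewrite inE => /orP[/eqP ->|/mP//]; split=> //.
  by apply: S_free_irreducible wU _ => //; rewrite -xE.
by rewrite !big_cons lE xE rmorphM mulrACA.
Qed.

Lemma atomic_descent : atomic L -> atomic R.
Proof.
move=> atL r r0 rU.
have [a [s [Ss rE fa]]] := S_free_decomposition sS r0.
have a0 : a != 0 by apply: contra_neq r0 => a0; rewrite rE a0 mul0r.
have [v [m [vU mP aE]]] : exists v (m : seq R), [/\ v \is a GRing.unit,
    forall a, a \in m -> S_free S a /\ irreducible_elt a &
    f a = v * f (\prod_(a <- m) a)].
  have [aU|aU] := boolP (f a \is a GRing.unit).
    by exists (f a), [::]; rewrite big_nil rmorph1 mulr1.
  have [|l [lI ->]] := atL (f a) _ aU; first by rewrite loc_eq0.
  exact: irreducible_representatives.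
have fm : S_free S (\prod_(b <- m) b) by apply: S_free_prod => b /mP[].
have [w wU {}aE] : exists2 w, w \is a GRing.unit & a = w * \prod_(b <- m) b.
  apply: divides_antisym => //; apply: S_free_divides_loc => //.
    by exists v^-1; rewrite aE mulKr.
  by exists v.
have [u [t [uU tP sE]]] := Sp Ss.
have rE' : r = (w * u) * \prod_(b <- m ++ t) b.
  by rewrite rE aE sE big_cat /= mulrACA.
rewrite rE'; apply: absorb_unit; rewrite -?rE' ?unitrMr //.
move=> b; rewrite mem_cat => /orP[/mP[]//|/tP[_]]; exact: prime_irreducible.
Qed.

(** * The ascending chain condition *)

(** Let the chain generated by the [y n] be stationary in R_S from N on.  Among
the [n >= N], choose M such that [y N / y n] is divisible by a product of
primes of S with as many factors as possible.  A quotient [y M / y n] with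
[n >= M] is a unit in R_S, hence lies in S; if it were not a unit of R, then
it would contribute one more prime of S. *)
Lemma ACCP_descent r : r != 0 -> satisfies_ACCP (f r) -> satisfies_ACCP r.
Proof.
move=> r0 accp I /choice[y IE] I0 Isub.
have chain n m : (n <= m)%N -> divides (y m) (y n).
  elim: m => [|m IHm]; first by rewrite leqn0 => /eqP ->; exact: divides_refl.
  rewrite leq_eqVlt => /orP[/eqP ->|/IHm]; first exact: divides_refl.
  by apply: divides_trans; apply/principal_ideal_sub; rewrite -!IE.
have /eq_principal_ideal[y0r ry0] : principal_ideal (y 0%N) = principal_ideal r.
  by rewrite -IE.
have y_neq0 n : y n != 0.
  have [k rE] := divides_trans (chain 0%N n isT) y0r.
  by apply: contra_neq r0 => yn0; rewrite rE yn0 mulr0.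
have [||n|N stab] := accp (fun n => principal_ideal (f (y n))).
- by move=> n; exists (f (y n)).
- by apply/eq_principal_ideal; split; exact: divides_loc.
- by apply/principal_ideal_sub/divides_loc/chain.
have [B BP] := S_prime_divisor_bound sS Sp (y_neq0 N).
pose P m := `[< exists n (t : seq R), [/\ (N <= n)%N,
  forall p, p \in t -> S_prime S p,
  divides (\prod_(p <- t) p * y n) (y N) & size t = m] >].
have P0 : P 0%N.
  by apply/asboolP; exists N, [::]; split=> //; rewrite big_nil mul1r;
    exact: divides_refl.
have Pbound m : P m -> (m <= B)%N.
  move=> /asboolP[n [t [_ tP tyn <-]]]; apply: BP => //.
  by apply: divides_trans tyn; exact/divides_mulr/divides_refl.
have [m /asboolP[M [t [NM tP tyM tm]]] max] :=
  ex_maxnP (ex_intro P _ P0) Pbound.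
exists M => n Mn; rewrite !IE; apply/eq_principal_ideal.
split; first exact: chain.
have [q qE] := chain M n Mn.
have Sq : S q.
  apply: loc_unit_S.
  have /eq_principal_ideal[[k kE] _] :
      principal_ideal (f (y M)) = principal_ideal (f (y n)).
    by rewrite (stab M NM) (stab n (leq_trans NM Mn)).
  apply/unitrPr; exists k; have yn0 : f (y n) != 0 by rewrite loc_eq0.
  by apply: (mulIf yn0); rewrite mul1r [RHS]kE qE rmorphM mulrA [k * _]mulrC.
have [qU|qU] := boolP (q \is a GRing.unit).
  by exists q^-1; rewrite qE mulKr.
have [p pS pq] := S_nonunit_divisor Sp Sq qU.
suff /max : P m.+1 by rewrite ltnn.
apply/asboolP; exists n, (p :: t); split; last by rewrite /= tm.
- exact: leq_trans Mn.
- by move=> p'; rewrite inE => /orP[/eqP ->|/tP].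
apply: divides_trans tyM; rewrite qE big_cons [p * _]mulrC -mulrA.
apply: divides_mul2l; rewrite mulrC [q * _]mulrC; exact: divides_mul2l.
Qed.

(** * The weak ACCP property *)

Theorem weak_ACCP_descent : weak_ACCP L -> weak_ACCP R.
Proof.
move=> [atL wL]; split; first exact: atomic_descent.
move=> W finW [w0 Ww0] W0.
have W_neq0 w : W w -> w != 0 by move=> Ww; apply/eqP => wE; rewrite wE in Ww.
have [|||d [dW [_ [c [[w Ww <-] wE accp]]]]] := wL (f @` W).
- exact: finite_image.
- by exists (f w0), w0.
- by case=> w /W_neq0 w_neq0 /eqP; rewrite loc_eq0 (negbTE w_neq0).
have d0 : d != 0.
  have : f w != 0 by rewrite loc_eq0 W_neq0.
  by apply: contra_neq => d0; rewrite wE d0 mulr0.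
have [a [v [fa vU dE]]] := S_free_representative d0.
have aW w' : W w' -> divides a w'.
  move=> Ww'; apply: S_free_divides_loc fa _.
  have [|k ->] := dW (f w'); first by exists w'.
  by exists (k * v); rewrite dE mulrA.
exists a; split=> //; have [b bE] := aW w Ww.
exists w, b; split=> //.
have := W_neq0 w Ww; rewrite bE mulf_eq0 negb_or => /andP[b0 a0].
apply: (ACCP_descent b0).
have cE : f b = c * v.
  have a0' : f a != 0 by rewrite loc_eq0.
  by apply: (mulIf a0'); rewrite -rmorphM -bE wE dE mulrA.
(* Being ACCP depends on the principal ideal only. *)
move=> I IP I0; apply: accp => //; rewrite I0; apply/eq_principal_ideal.
split; last by exists v; rewrite cE mulrC.
by exists v^-1; rewrite cE mulrC mulrK.
Qed.

End LocalizationMap.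

(** * The subring of fractions *)

Local Notation "x %:F" := (@FracField.tofrac _ x).

Section Localization.
Variables (R : idomainType) (S : set R) (mS : multiplicative_subset S).
Local Notation L := (localization mS).

Lemma tofrac_fractions (a : R) : a%:F \in fractions_over mS.
Proof.
by apply/asboolP; exists a, 1; have [S1 _ _] := mS; rewrite tofrac1 divr1.
Qed.

Definition toL (a : R) : L := Sub a%:F (tofrac_fractions a).

Fact toL_is_zmod_morphism : zmod_morphism toL.
Proof. by move=> a b; apply: val_inj; rewrite rmorphB /= tofracB. Qed.

Fact toL_is_monoid_morphism : monoid_morphism toL.
Proof.
split=> [|a b]; apply: val_inj; first by rewrite rmorph1 /= tofrac1.
by rewrite rmorphM /= tofracM.
Qed.

HB.instance Definition _ :=
  GRing.isZmodMorphism.Build R L toL toL_is_zmod_morphism.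
HB.instance Definition _ :=
  GRing.isMonoidMorphism.Build R L toL toL_is_monoid_morphism.

Lemma toL_localization_map : localization_map S toL.
Proof.
split=> [a b /(congr1 val) /= /eqP|s Ss|x].
- by rewrite tofrac_eq => /eqP.
- have s0 := tofrac_neq0 mS Ss.
  have sV : s%:F^-1 \in fractions_over mS.
    by apply/asboolP; exists 1, s; rewrite tofrac1 div1r.
  apply/unitrPr; exists (Sub s%:F^-1 sV : L); apply: val_inj.
  by rewrite rmorphM rmorph1 /= mulfV.
- have /asboolP[a [s [Ss xE]]] := valP x; exists a, s; split=> //.
  by apply: val_inj; rewrite rmorphM /= xE divfK // (tofrac_neq0 mS).
Qed.

End Localization.

Theorem proposition4p6 (R : idomainType) (S : set R)
    (mS : multiplicative_subset S) :
  splitting S -> generated_by_primes S ->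
  weak_ACCP (localization mS) -> weak_ACCP R.
Proof.
by move=> sS Sp; exact: weak_ACCP_descent (toL_localization_map mS) sS Sp.
Qed.
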